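(* Let $K\ge 1$ be an integer. Let $\mathbf{c}_n=(c_n^1,\dots,c_n^K)$, $n\ge 0$, be random vectors such that all the $c_n^i$ ($n\ge0$, $1\le i\le K$) are i.i.d. with distribution $\mathcal{U}(0,1)$ and independent of $r_0$, and define $r_{n+1}=T_{K+1}(\mathbf{c}_n,r_n)$ for $n\ge 0$, with $T_{K+1}$ as given in the context. If $r_0\sim\mathcal{U}(0,1)$, then $r_n\sim\mathcal{U}(0,1)$ for all $n\ge 1$; that is, $\mathcal{U}(0,1)$ is a stationary distribution for the $K$-cuts algorithm.
   Context: $\mathcal{U}(0,1)$ is the uniform distribution on $(0,1)$. For $\mathbf{c}=(c^1,\dots,c^K)\in[0,1]^K$, let $c^{(1)}\le\dots\le c^{(K)}$ be its entries in nondecreasing order, and set $c^{(0)}:=0$, $c^{(K+1)}:=1$. The rescaling map is $$T_{K+1}(\mathbf{c},r)=\frac{r-c^{(i)}}{c^{(i+1)}-c^{(i)}}\qquad\text{if } c^{(i)}\le r<c^{(i+1)}\quad(i=0,\dots,K),$$ with an arbitrary value in $[0,1]$ (say $1$) for $r=1$, an event of probability zero. The $K$-cuts algorithm cuts the current interval (rescaled to $[0,1]$) at $K$ independent uniform points, keeps the subinterval containing the root, and rescales it to $[0,1]$; $r_n$ is the rescaled root. *)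

(* Defs.v *)
From HB Require Import structures.
From mathcomp Require Import all_boot all_order all_algebra finmap.
From mathcomp Require Import all_classical all_reals all_analysis.

Set Implicit Arguments.
Unset Strict Implicit.
Unset Printing Implicit Defensive.

Import Order.TTheory GRing.Theory Num.Theory.
Import numFieldNormedType.Exports.

Local Open Scope classical_set_scope.
Local Open Scope ring_scope.

(* The laws are compared on measurable sets only: a library measure is a
   function on all sets, with meaningless values on non-measurable ones. *)
Definition has_law d d' (Omega : measurableType d) (T : measurableType d')
    (R : realType) (P : probability Omega R) (X : Omega -> T)
    (mu : set T -> \bar R) : Prop :=
  measurable_fun [set: Omega] X /\
  forall A : set T, measurable A -> pushforward P X A = mu A.

Definition mutually_independent d d' (Omega : measurableType d)
    (T : measurableType d') (R : realType) (P : probability Omega R)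
    (I : choiceType) (X : I -> Omega -> T) : Prop :=
  forall (J : {fset I}) (A : I -> set T), (forall i, measurable (A i)) ->
    (P (\bigcap_(i in [set` J]) (X i @^-1` A i)) =
     \prod_(i <- J) P (X i @^-1` A i))%E.

Definition sigma_generated d' (Omega : Type) (T : measurableType d') (I : Type)
    (X : I -> Omega -> T) : set_system Omega :=
  <<s \bigcup_i preimage_set_system [set: Omega] (X i) measurable >>.

Definition independent_systems d (Omega : measurableType d) (R : realType)
    (P : probability Omega R) (F G : set_system Omega) : Prop :=
  forall E1 E2, F E1 -> G E2 -> (P (E1 `&` E2) = P E1 * P E2)%E.

(* Entry i of this list is c^(i), for i = 0, ..., K+1. *)
Definition order_stats (R : realType) (K : nat) (c : 'I_K -> R) : seq R :=
  0 :: rcons (sort <=%R [seq c i | i : 'I_K]) 1.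

(* When all the entries of c lie in [0, 1], at most one i qualifies, and one
   does exactly when 0 <= r < 1.  The default v is the arbitrary value at r = 1;
   it also makes the map total. *)
Definition rescale (R : realType) (v : R) (K : nat) (c : 'I_K -> R) (r : R) : R :=
  let s := order_stats c in
  if [pick i : 'I_K.+1 | s`_i <= r < s`_i.+1] is Some i
  then (r - s`_i) / (s`_i.+1 - s`_i)
  else v.

(* Main.v *)
Require Import Defs.
From HB Require Import structures.
From mathcomp Require Import all_boot all_order all_algebra finmap.
From mathcomp Require Import all_classical all_reals all_analysis.
From mathcomp Require Import measurable_realfun ring lra.

Set Implicit Arguments.
Unset Strict Implicit.
Unset Printing Implicit Defensive.

Import Order.TTheory GRing.Theory Num.Theory.
Import numFieldNormedType.Exports.

Local Open Scope classical_set_scope.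
Local Open Scope ring_scope.

(** The point is that the cuts need not be random: for every fixed vector [c]
    of cuts in [0, 1], the map [rescale v c] preserves the uniform law.  Indeed
    it maps each nonempty interval between two consecutive cuts, with 0 and 1
    counted as cuts, affinely onto [0, 1), so that the part of the preimage of
    [A] lying in an interval of length [l] has measure [l] times the measure of
    [A] in [0, 1), and the lengths add up to 1 ([uniform_prob_rescale]).

    If the root is uniform and independent of the cuts, conditioning on the cuts
    therefore gives a rescaled root whose conditional law is still uniform: it
    is uniform and again independent of the cuts.  The induction has to carry
    independence from the whole sequence of cuts, past and future, since the
    next step uses cuts that have not been used yet.  The family of all cuts is
    encoded as the identity map from Omega to Omega equipped with the
    sigma-algebra that they generate; every cut is a measurable function of
    this single random element.

    Conditioning is expressed with a product measure: independence says that
    the joint law of the cuts and the root is a product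
    ([indep_law_joint]), and the measure of a preimage under a map of both
    coordinates is the integral of the measures of its sections
    ([indep_law_skew]).  This needs [rescale] to be jointly measurable in the
    cuts and the root, hence the order statistics to be measurable
    ([measurable_rescale]). *)

(** * Measurability of the rescaling map *)

(** This turns an event about an order statistic into one about the number of
    entries below a level, which is a sum of measurable indicators. *)
Lemma nth_sort_ge (R : realDomainType) (s : seq R) (x : R) (i : nat) :
  (i < size s)%N ->
  (x <= (sort <=%R s)`_i) = (count (fun y => (y < x)%R) s <= i)%N.
Proof.
move=> si; have ss : sorted <=%R (sort <=%R s) by exact/sort_sorted/le_total.
have -> : count (fun y => (y < x)%R) s = count (< x) (sort <=%R s).
  by apply/permP; rewrite perm_sym perm_sort.
apply/idP/idP => [xs|cs].
  by rewrite leqNgt; apply: contraTN xs => /(nth_count_lt 0 ss); rewrite -ltNge.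
by apply: nth_count_ge => //; rewrite cs size_sort.
Qed.

Lemma measurable_nth_sort d (T : measurableType d) (R : realType) (K : nat)
    (c : 'I_K -> T -> R) (i : nat) :
  (forall j, measurable_fun [set: T] (c j)) ->
  measurable_fun [set: T] (fun w => (sort <=%R [seq c j w | j : 'I_K])`_i).
Proof.
move=> mc; have [iK|Ki] := ltnP i K; last first.
  rewrite [X in measurable_fun _ X](_ : _ = cst 0)//; apply/funext => w /=.
  by rewrite nth_default// size_sort size_image card_ord.
move=> mT; apply: (measurability _ (RGenCInfty.measurableE R)) => //.
move=> /= _ [_ [x ->] <-]; rewrite preimage_itvcy.
have mS : measurable_fun [set: T]
    (fun w => \sum_j (if c j w < x then 1 else 0) <= i%:R :> R).
  apply: measurable_fun_ler => //; apply: measurable_sum => j.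
  by apply: measurable_fun_ifT => //; exact: measurable_fun_ltr.
rewrite [X in measurable X](_ : _ = [set: T] `&`
  (fun w => \sum_j (if c j w < x then 1 else 0) <= i%:R :> R) @^-1` [set true]).
  exact: mS.
congr (_ `&` _); apply/seteqP.
suff E w : (x <= (sort <=%R [seq c j w | j : 'I_K])`_i) =
    (\sum_j (if c j w < x then 1 else 0) <= i%:R :> R).
  by split=> w /=; rewrite E.
rewrite nth_sort_ge ?size_image ?card_ord// -(ler_nat R) count_map -sum1_count.
rewrite natr_sum big_mkcond/= big_enum/=; congr (_ <= _).
Qed.

Lemma measurable_order_stats d (T : measurableType d) (R : realType) (K : nat)
    (c : 'I_K -> T -> R) (i : nat) :
  (forall j, measurable_fun [set: T] (c j)) ->
  measurable_fun [set: T] (fun w => (order_stats (c ^~ w))`_i).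
Proof.
move=> mc; case: i => [|i]/=; first exact: measurable_cst.
under eq_fun do rewrite nth_rcons size_sort size_image card_ord.
case: (i < K)%N; first exact: measurable_nth_sort.
by case: (i == K); exact: measurable_cst.
Qed.

(** Picking from a finite type is a finite cascade of tests. *)
Lemma measurable_fun_pick d d' (T : measurableType d) (U : measurableType d')
    (I : finType) (p : I -> T -> bool) (f : I -> T -> U) (v : U) :
  (forall i, measurable_fun [set: T] (p i)) ->
  (forall i, measurable_fun [set: T] (f i)) ->
  measurable_fun [set: T]
    (fun w => if [pick i | p i w] is Some i then f i w else v).
Proof.
move=> mp mf; rewrite /pick /enum_mem; elim: (Finite.enum I) => [|i s IH] /=.
  exact: measurable_cst.
rewrite [X in measurable_fun _ X](_ : _ = fun w => if p i w then f i w else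
    if ohead [seq j <- s | mem (p ^~ w) j] is Some i then f i w else v).
  exact: measurable_fun_ifT.
by apply/funext => w; rewrite -topredE/=; case: (p i w).
Qed.

Lemma measurable_invr (R : realType) :
  measurable_fun [set: R] (@GRing.inv R).
Proof.
rewrite [X in measurable_fun _ X](_ : _ =
    fun x : R => if x != 0 then x^-1 else 0); last first.
  by apply/funext => x; case: eqVneq => [->|//]; rewrite invr0.
apply: measurable_fun_if => //.
  by apply: measurable_neg; exact: measurable_fun_eqr.
rewrite setTI [X in measurable_fun X _](_ : _ = [set x : R | x != 0]).
  apply: open_continuous_measurable_fun; first exact: open_neq.
  by apply/in_setP => x /= x0; exact: inv_continuous.
by apply/seteqP; split => x.
Qed.

Lemma measurable_rescale d (T : measurableType d) (R : realType) (v : R)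
    (K : nat) (c : 'I_K -> T -> R) (r : T -> R) :
  (forall j, measurable_fun [set: T] (c j)) -> measurable_fun [set: T] r ->
  measurable_fun [set: T] (fun w => rescale v (c ^~ w) (r w)).
Proof.
move=> mc mr; apply: measurable_fun_pick => i.
  by apply: measurable_and; [apply: measurable_fun_ler|apply: measurable_fun_ltr];
    rewrite //; exact: measurable_order_stats.
apply: measurable_funM.
  by apply: measurable_funB => //; exact: measurable_order_stats.
apply: (measurableT_comp (@measurable_invr R)).
by apply: measurable_funB => //; exact: measurable_order_stats.
Qed.

(** * Invariance of the uniform law for fixed cuts *)

Lemma measurable_affine (R : realType) (s l : R) :
  measurable_fun [set: R] (fun x => (x - s) / l).
Proof. by apply: measurable_funM => //; exact: measurable_funB. Qed.

(** The pushforward divided by [l] agrees with the Lebesgue measure on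
    half-open intervals, which determines it. *)
Lemma lebesgue_measure_affine (R : realType) (s l : R) (B : set R) :
  0 < l -> measurable B ->
  lebesgue_measure ((fun x => (x - s) / l) @^-1` B) =
  (l%:E * lebesgue_measure B)%E.
Proof.
move=> l0 mB; have l0' : 0 <= l^-1 by rewrite invr_ge0 ltW.
pose g (x : measurableTypeR R) : measurableTypeR R := (x - s) / l.
have mg : measurable_fun [set: measurableTypeR R] g by exact: measurable_affine.
pose nu : {measure set (measurableTypeR R) -> \bar R} :=
  mscale (NngNum l0') (pushforward (@lebesgue_measure R) g).
have muE : lebesgue_measure B = nu mg B.
  apply: lebesgue_measure_unique => // _ [[a b] _ <-].
  rewrite /= /mscale /pushforward /=.
  rewrite [X in (_ * lebesgue_measure X)%E](_ : _ =
      `](s + l * a), (s + l * b)]%classic).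
    rewrite !lebesgue_measure_itv/= !lte_fin ltrD2l ltr_pM2l//.
    case: ifPn => _; last by rewrite mule0.
    by rewrite -!EFinD -EFinM; congr (_ %:E); field; rewrite gt_eqF.
  apply/seteqP; split => x /=; rewrite !in_itv/= /g ltr_pdivlMr// ler_pdivrMr//;
    by move=> /andP[? ?]; apply/andP; split; lra.
rewrite muE /= /mscale/= muleA -EFinM mulfV ?gt_eqF// mul1e.
by [].
Qed.

(** The right endpoint is dropped, at no cost in measure, because the intervals
    between cuts are closed on the left and open on the right. *)
Lemma uniform_prob01E (R : realType) (A : set R) : measurable A ->
  uniform_prob (@ltr01 R) A = lebesgue_measure (A `&` `[0, 1[).
Proof.
move=> mA; rewrite /uniform_prob integral_uniform_pdf.
rewrite (eq_integral (cst 1%E)); last first.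
  by move=> x; rewrite inE/= in_itv/= /uniform_pdf => -[_ ->];
    rewrite subr0 invr1.
rewrite integral_cst//= ?mul1e; last exact: measurableI.
have -> : A `&` `[0, 1] = (A `&` `[0, 1[) `|` (A `&` [set 1]).
  by rewrite -setIUr setUitv1// bnd_simp.
rewrite measureU//=.
- rewrite [X in (_ + X)%E](_ : _ = 0%E) ?adde0//.
  apply/eqP; rewrite eq_le measure_ge0 andbT.
  rewrite -(lebesgue_measure_set1 (1:R)) le_measure// ?inE//.
  exact: measurableI.
- exact: measurableI.
- exact: measurableI.
- apply/seteqP; split => // x [[_ /= x01] [_ /= x1]]; move: x01.
  by rewrite x1 in_itv/= ltxx andbF.
Qed.

Lemma exists_step (R : realDomainType) (s : nat -> R) (n : nat) (x : R) :
  s 0%N <= x < s n -> exists i : 'I_n, s i <= x < s i.+1.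
Proof.
elim: n => [|n IH] /andP[x0 xn].
  by have := le_lt_trans x0 xn; rewrite ltxx.
have [xsn|snx] := ltP x (s n); last by exists ord_max; rewrite snx.
by have [|i si] := IH; [rewrite x0|exists (widen_ord (leqnSn n) i)].
Qed.

Lemma unique_step (R : realDomainType) (s : nat -> R) (x : R) (i j : nat) :
  {homo s : m n / (m <= n)%N >-> m <= n} ->
  s i <= x < s i.+1 -> s j <= x < s j.+1 -> i = j.
Proof.
move=> smono; wlog ij : i j / (i <= j)%N => [H Hi Hj|].
  by have [|/ltnW] := leqP i j => ij; [exact: H|apply/esym/H].
move=> /andP[_ xi] /andP[jx _]; move: ij; rewrite leq_eqVlt => /predU1P[//|ij].
by have := le_lt_trans (le_trans (smono _ _ ij) jx) xi; rewrite ltxx.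
Qed.

Lemma uniform_prob_rescale (R : realType) (v : R) (K : nat) (c : 'I_K -> R)
    (A : set R) :
  (forall i, 0 <= c i <= 1) -> measurable A ->
  uniform_prob (@ltr01 R) (rescale v c @^-1` A) = uniform_prob (@ltr01 R) A.
Proof.
move=> c01 mA.
(* Truncating the index makes [s] nondecreasing on all of [nat]; past its end
   the list takes the default value 0. *)
pose s i := (order_stats c)`_(minn i K.+1).
have sE i : (i <= K.+1)%N -> s i = (order_stats c)`_i.
  by move=> /minn_idPl; rewrite /s => ->.
have s0 : s 0%N = 0 by [].
have sK : s K.+1 = 1.
  by rewrite sE//= nth_rcons size_sort size_image card_ord ltnn eqxx.
have smono : {homo s : m n / (m <= n)%N >-> m <= n}.
  have ss : sorted <=%R (order_stats c).
    rewrite /= rcons_path path_sortedE; last exact: le_trans.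
    rewrite sort_sorted ?andbT; last exact: le_total.
    have all01 (p : pred R) : (forall i, p (c i)) ->
        all p (sort <=%R [seq c i | i : 'I_K]).
      by move=> pc; rewrite all_sort; apply/allP => _ /mapP[i _ ->].
    rewrite all01 => [|i]; last by have /andP[] := c01 i.
    have /allP : all (<= 1) (0 :: sort <=%R [seq c i | i : 'I_K]).
      by rewrite /= ler01 all01// => i; have /andP[] := c01 i.
    by apply; exact: mem_last.
  move=> m n mn; apply: (sorted_leq_nth le_trans lexx) => //.
  - by rewrite inE/= size_rcons size_sort size_image card_ord ltnS geq_minr.
  - by rewrite inE/= size_rcons size_sort size_image card_ord ltnS geq_minr.
  - by rewrite leq_min geq_minr andbT (leq_trans (geq_minl _ _)).
have rescaleE (i : 'I_K.+1) (x : R) : s i <= x < s i.+1 ->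
    rescale v c x = (x - s i) / (s i.+1 - s i).
  move=> six; rewrite /rescale; case: pickP => [j|/(_ i)]; last first.
    by rewrite -!sE ?six// ltnW.
  rewrite -!sE// 1?ltnW// => sjx; suff -> : i = j by [].
  exact/val_inj/(unique_step smono six sjx).
(* The preimage of [A] between the cuts of ranks [i] and [i.+1] is an affine
   preimage of [A] in [0, 1), or is empty when the two cuts coincide. *)
pose D (i : 'I_K.+1) : set R := `[s i, s i.+1[ `&` rescale v c @^-1` A.
have DE (i : 'I_K.+1) : s i < s i.+1 -> D i =
    (fun x => (x - s i) / (s i.+1 - s i)) @^-1` (A `&` `[0, 1[).
  move=> si; have l0 : 0 < s i.+1 - s i by rewrite subr_gt0.
  have E x : ((x - s i) / (s i.+1 - s i) \in `[0, 1[) = (s i <= x < s i.+1).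
    by rewrite in_itv/= ler_pdivlMr// ltr_pdivrMr// mul0r mul1r subr_ge0 ltrD2r.
  apply/seteqP; split => x; rewrite /D /= E in_itv/=.
    by move=> [six]; rewrite (rescaleE i).
  by move=> [? six]; rewrite (rescaleE i).
have D0 (i : 'I_K.+1) : ~~ (s i < s i.+1) -> D i = set0.
  by move=> si; rewrite /D set_itv_ge ?set0I// bnd_simp.
have mD i : measurable (D i).
  have [si|si] := boolP (s i < s i.+1); last by rewrite D0.
  rewrite DE// -[X in measurable X]setTI; apply: measurable_affine => //.
  exact: measurableI.
have muD i : lebesgue_measure (D i) =
    ((s i.+1 - s i)%:E * lebesgue_measure (A `&` `[0%R, 1%R[))%E.
  have [si|si] := boolP (s i < s i.+1).
    by rewrite DE// lebesgue_measure_affine// ?subr_gt0//; exact: measurableI.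
  have -> : s i.+1 = s i by apply/eqP; rewrite eq_le (smono i)// leNgt si.
  by rewrite D0// ?ltxx// subrr mul0e measure0.
have mR : measurable (rescale v c @^-1` A).
  rewrite -[X in measurable X]setTI.
  exact: (@measurable_rescale _ _ R v K (fun i => cst (c i)) id).
rewrite !uniform_prob01E//.
have -> : rescale v c @^-1` A `&` `[0, 1[ = \big[setU/set0]_(i < K.+1) D i.
  rewrite -bigcup_seq; apply/seteqP; split => x.
    move=> [Ax]; rewrite /= in_itv/= -s0 -sK => /exists_step[i six].
    by exists i; [exact: mem_index_enum|split].
  move=> [i _] [/=]; rewrite in_itv/= => /andP[six xsi] Ax.
  rewrite in_itv/=; split => //; apply/andP; split.
    by apply: le_trans six; rewrite -s0 smono.
  by apply: (lt_le_trans xsi); rewrite -sK smono.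
rewrite measure_semi_additive_ord//; last 2 first.
- apply/trivIsetP => i j _ _ ij; apply/seteqP; split => // x [[xi _] [xj _]].
  by move: ij; rewrite (val_inj (unique_step smono xi xj)) eqxx.
- by apply: bigsetU_measurable => i _; exact: mD.
rewrite (eq_bigr _ (fun i _ => muD i)).
rewrite -ge0_sume_distrl => [|i _]; last by rewrite lee_fin subr_ge0 smono.
rewrite sumEFin -(big_mkord xpredT (fun i => s i.+1 - s i)).
by rewrite telescope_sumr// sK s0 subr0 mul1e.
Qed.

(** * Independence preserved by fiberwise measure-preserving maps *)

(** [Y] is independent of [X] and has law [nu], in a single formula: taking
    [E = setT] gives the law. *)
Definition indep_law d d1 d2 (Omega : measurableType d)
    (T1 : measurableType d1) (T2 : measurableType d2) (R : realType)
    (P : probability Omega R) (X : Omega -> T1) (Y : Omega -> T2)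
    (nu : set T2 -> \bar R) : Prop :=
  forall (E : set T1) (A : set T2), measurable E -> measurable A ->
    (P (X @^-1` E `&` Y @^-1` A) = P (X @^-1` E) * nu A)%E.

Lemma indep_law_law d d1 d2 (Omega : measurableType d)
    (T1 : measurableType d1) (T2 : measurableType d2) (R : realType)
    (P : probability Omega R) (X : Omega -> T1) (Y : Omega -> T2)
    (nu : set T2 -> \bar R) (A : set T2) :
  indep_law P X Y nu -> measurable A -> P (Y @^-1` A) = nu A.
Proof.
move=> ind mA; have := ind setT A measurableT mA.
by rewrite preimage_setT setTI probability_setT mul1e.
Qed.

(** Both measures agree on rectangles, which determine a finite measure. *)
Lemma indep_law_joint d d1 d2 (Omega : measurableType d)
    (T1 : measurableType d1) (T2 : measurableType d2) (R : realType)
    (P : probability Omega R) (X : {mfun Omega >-> T1})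
    (Y : {mfun Omega >-> T2}) (nu : set T2 -> \bar R) (Z : set (T1 * T2)) :
  indep_law P X Y nu -> measurable Z ->
  P ((fun w => (X w, Y w)) @^-1` Z) =
  (distribution P X \x distribution P Y)%E Z.
Proof.
move=> ind mZ; have mXY : measurable_fun [set: Omega] (fun w => (X w, Y w)).
  exact: measurable_fun_pair.
pose XY : {mfun Omega >-> (T1 * T2)%type} := mfun_Sub (mem_set mXY).
rewrite (product_measure_unique (m' := distribution P XY))// => E A mE mA.
transitivity (P (X @^-1` E `&` Y @^-1` A)); first by [].
by rewrite ind// -(indep_law_law ind mA).
Qed.

(** If, for almost every value [x] of [X], the map [F (x, -)] preserves [nu],
    then knowing [X] says nothing about [F (X, Y)]. *)
Lemma indep_law_skew d d1 d2 (Omega : measurableType d)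
    (T1 : measurableType d1) (T2 : measurableType d2) (R : realType)
    (P : probability Omega R) (X : {mfun Omega >-> T1})
    (Y : {mfun Omega >-> T2}) (nu : set T2 -> \bar R) (F : T1 * T2 -> T2) :
  measurable_fun [set: T1 * T2] F ->
  {ae distribution P X, forall x, forall A, measurable A ->
     nu ((fun y => F (x, y)) @^-1` A) = nu A} ->
  indep_law P X Y nu -> indep_law P X (fun w => F (X w, Y w)) nu.
Proof.
move=> mF Fnu ind E A mE mA.
have mFA : measurable (F @^-1` A).
  by rewrite -[X in measurable X]setTI; exact: mF.
have mZ : measurable (E `*` setT `&` F @^-1` A).
  by apply: measurableI => //; exact: measurableX.
have nuA0 : (0 <= nu A)%E by rewrite -(indep_law_law ind mA).
transitivity (P ((fun w => (X w, Y w)) @^-1` (E `*` setT `&` F @^-1` A))).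
  by congr (P _); apply/seteqP; split => w /= [] // [].
rewrite (indep_law_joint ind mZ) /product_measure1.
(* The section at [x] is [F (x, -) @^-1` A] if [x] is in [E], else empty. *)
transitivity (\int[distribution P X]_(x in setT) ((\1_E x)%:E * nu A))%E.
  apply: ge0_ae_eq_integral => //.
  - exact: measurable_fun_xsection.
  - by apply: emeasurable_funM => //; exact/measurable_EFinP.
  - by move=> x _; rewrite mule_ge0// lee_fin.
  move: Fnu; apply: filterS => x Fx _ /=; rewrite indicE.
  have mFxA : measurable ((fun y => F (x, y)) @^-1` A).
    rewrite -[X in measurable X]setTI.
    exact: (measurableT_comp mF (pair1_measurable x)).
  have [xE|xE] := boolP (x \in E).
    rewrite mul1e -(Fx _ mA) -(indep_law_law ind mFxA); congr (P _).
    apply/seteqP; split => w; rewrite /xsection/= inE/=.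
      by case.
    by move=> Fxy; split => //; split => //; exact: set_mem.
  rewrite mul0e (_ : xsection _ _ = set0) ?measure0//.
  apply/seteqP; split => y //; rewrite /xsection/= inE/= => -[[]] /=.
  by move=> /mem_set; rewrite (negbTE xE).
rewrite ge0_integralZr//; last exact/measurable_EFinP.
by rewrite integral_indic// setIT.
Qed.

(** * Stationarity *)

Lemma uniform_ae01 d (Omega : measurableType d) (R : realType)
    (P : probability Omega R) (f : Omega -> R) :
  has_law P f (uniform_prob (@ltr01 R)) -> P (~` (f @^-1` `[0, 1])) = 0%E.
Proof.
move=> [mf fE]; rewrite probability_setC; last first.
  by rewrite -[X in measurable X]setTI; exact: mf.
have := fE _ (measurable_itv `[0, 1]); rewrite /pushforward => ->.
by rewrite /uniform_prob integral_uniform_pdf1// subee.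
Qed.

(** One step of the algorithm.  [X] stands for all the randomness in the cuts,
    of which [c] is the part used in this step. *)
Lemma indep_law_rescale d d1 (Omega : measurableType d)
    (T : measurableType d1) (R : realType) (P : probability Omega R)
    (X : {mfun Omega >-> T}) (v : R) (K : nat) (c : 'I_K -> T -> R)
    (r : Omega -> R) :
  (forall i, measurable_fun [set: T] (c i)) ->
  {ae distribution P X, forall x, forall i, 0 <= c i x <= 1} ->
  measurable_fun [set: Omega] r ->
  indep_law P X r (uniform_prob (@ltr01 R)) ->
  indep_law P X (fun w => rescale v (c ^~ (X w)) (r w))
    (uniform_prob (@ltr01 R)).
Proof.
move=> mc c01 mr ind.
pose F (z : T * R) := rescale v (c ^~ z.1) z.2.
have mF : measurable_fun [set: T * R] F.
  apply: (@measurable_rescale _ _ R v K (fun i z => c i z.1) snd) => // j.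
  exact: (measurableT_comp (mc j)).
pose Y : {mfun Omega >-> R} := mfun_Sub (mem_set mr).
apply: (@indep_law_skew _ _ _ _ _ _ _ P X Y _ F) => //.
apply: filterS c01 => x cx01 A mA.
rewrite -[_ @^-1` A]/(rescale v (c ^~ x) @^-1` A).
by rewrite (uniform_prob_rescale v cx01 mA).
Qed.

Theorem proposition15 (R : realType) (d : measure_display)
  (Omega : measurableType d) (P : probability Omega R)
  (K : nat) (hK : (1 <= K)%N)
  (v : R) (hv : 0 <= v <= 1)
  (c : nat -> 'I_K -> Omega -> R) (r : nat -> Omega -> R)
  (c_unif : forall n i, has_law P (c n i) (uniform_prob (@ltr01 R)))
  (c_indep : mutually_independent P (fun p : nat * 'I_K => c p.1 p.2))
  (c_r0_indep : independent_systems P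
     (sigma_generated (fun p : nat * 'I_K => c p.1 p.2))
     (preimage_set_system [set: Omega] (r 0%N) measurable))
  (r_rec : forall n w, r n.+1 w = rescale v (fun i => c n i w) (r n w))
  (r0_unif : has_law P (r 0%N) (uniform_prob (@ltr01 R))) :
  forall n, (1 <= n)%N -> has_law P (r n) (uniform_prob (@ltr01 R)).
Proof.
move=> n _.
pose G : set_system Omega := \bigcup_p preimage_set_system [set: Omega]
  ((fun p : nat * 'I_K => c p.1 p.2) p) measurable.
(* The sample space seen through the cuts only: [X] below generates exactly the
   events that the cuts determine. *)
pose OmegaC := g_sigma_algebraType G.
have mcC m i : measurable_fun [set: OmegaC] (c m i).
  move=> _ B mB; apply: sub_sigma_algebra; exists (m, i) => //.
  by exists B.
have mC (E : set Omega) : @measurable _ OmegaC E -> measurable E.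
  apply: smallest_sub; first exact: sigma_algebra_measurable.
  move=> _ [p _ [B mB <-]]; have [mc _] := c_unif p.1 p.2; exact: mc.
have mid : measurable_fun [set: Omega] (id : Omega -> OmegaC).
  by move=> _ B mB; rewrite setTI; exact: mC.
pose X : {mfun Omega >-> OmegaC} := mfun_Sub (mem_set mid).
suff [mr ind] : measurable_fun [set: Omega] (r n) /\
    indep_law P X (r n) (uniform_prob (@ltr01 R)).
  by split=> // A mA; exact: (indep_law_law ind mA).
elim: n => [|n [mr ind]].
  have [mr r0E] := r0_unif; split => // E A mE mA.
  rewrite c_r0_indep//; last by exists A => //; rewrite setTI.
  by rewrite -r0E.
have -> : r n.+1 = fun w => rescale v ((c n) ^~ (X w)) (r n w).
  by apply/funext => w; rewrite r_rec.
split.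
  by apply: measurable_rescale => // i; have [mc _] := c_unif n i.
apply: indep_law_rescale => //.
apply: filter_forall => i; exists (~` (c n i @^-1` `[0, 1])); split.
- by apply: measurableC; rewrite -[X in measurable X]setTI; exact: (mcC n i).
- exact: (uniform_ae01 (c_unif n i)).
- by apply: subsetC => w /=; rewrite in_itv.
Qed.
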